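(* Let $X$ be a real-valued random variable with probability measure $P_X$ (a Borel probability measure on $\mathbb{R}$), and for $c\in\mathbb{R}$ let $L(c)=\lim_{M\to\infty}\int_{[c-M,c+M]}x\,P_X(dx)$, whenever this limit exists in $[-\infty,\infty]$. Then exactly one of the following possibilities holds: i) $L(c)$ does not exist in $[-\infty,\infty]$ for any real number $c$; ii) $L(c)$ exists in $(-\infty,\infty)$ for exactly one real number $c$; iii) $L(c)$ exists in $[-\infty,\infty]$ for all real numbers $c$ and is independent of $c$; iv) there is a real number $c_0$ such that $L(c)=\infty$ for all $c>c_0$ and $L(c)$ does not exist in $[-\infty,\infty]$ for all $c<c_0$; v) there is a real number $c_0$ such that $L(c)=-\infty$ for all $c<c_0$ and $L(c)$ does not exist in $[-\infty,\infty]$ for all $c>c_0$.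
   Context: $P_X$ denotes the distribution of $X$, i.e. $P_X(A)$ is the probability that $X\in A$ for Borel $A\subseteq\mathbb{R}$. The limit defining $L(c)$ is taken over real $M\to\infty$, and the values $\pm\infty$ are allowed; ''does not exist'' means that there is no limit in the extended reals $[-\infty,\infty]$. *)

(* Defs.v *)
From mathcomp Require Import all_boot all_order all_algebra.
From mathcomp Require Import all_classical all_reals all_analysis.
Set Implicit Arguments.
Unset Strict Implicit.
Unset Printing Implicit Defensive.
Import Order.TTheory GRing.Theory Num.Theory.
Import numFieldNormedType.Exports.
Local Open Scope classical_set_scope.
Local Open Scope ring_scope.

Definition truncated_mean (d : measure_display) (T : measurableType d)
    (R : realType) (P : probability T R) (X : {RV P >-> R}) (c M : R) : \bar R :=
  \int[distribution P X]_(x in `[c - M, c + M]) x%:E.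

(* Convergence is in the topology of \bar R, so infinite limits count. *)
Definition L_exists (d : measure_display) (T : measurableType d)
    (R : realType) (P : probability T R) (X : {RV P >-> R}) (c : R) : Prop :=
  cvg (truncated_mean X c M @[M --> +oo]).

(* Meaningful only under [L_exists X c]: [lim] is total. *)
Definition L (d : measure_display) (T : measurableType d)
    (R : realType) (P : probability T R) (X : {RV P >-> R}) (c : R) : \bar R :=
  lim (truncated_mean X c M @[M --> +oo]).

(* Indices beyond the end of the list select [False]. *)
Definition exactly_one (Ps : seq Prop) : Prop :=
  exists! i : nat, nth False Ps i.

(* Main.v *)
(* Put U y = E[X; 0 <= X <= y] and V y = E[-X; -y <= X < 0].  For M >= |c| the
   truncated mean is U (M + c) - V (M - c), which is nondecreasing in c.  Both U
   and V are o(y), because P(|X| > K) -> 0.  Hence for a < b the gap between the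
   truncated means centred at a and b cannot stay bounded below as M grows, so
   any two existing limits coincide.  If the limit exists and is finite at two
   points a < b, then U (M + b) - U (M + a) and V (M - a) - V (M - b) tend to 0;
   shifting M spreads the limit to points arbitrarily far on both sides, and
   monotonicity in c fills in the rest.  If the common value is +oo (resp. -oo),
   monotonicity makes the set of c where the limit exists an up-set (resp. a
   down-set). *)
Require Import Defs.
From mathcomp Require Import all_boot all_order all_algebra.
From mathcomp Require Import all_classical all_reals all_analysis.
From mathcomp Require Import ring lra.
Set Implicit Arguments.
Unset Strict Implicit.
Unset Printing Implicit Defensive.
Import Order.TTheory GRing.Theory Num.Theory.
Import numFieldNormedType.Exports.
Local Open Scope classical_set_scope.
Local Open Scope ring_scope.

(** A one-sided little-o at infinity, put as affine bounds of arbitrarily small slope so that it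
    applies at every nonnegative point. *)
Definition sublinear (R : realType) (f : R -> R) : Prop :=
  forall e, 0 < e -> exists C, forall y, 0 <= y -> f y <= C + e * y.

Lemma lte_dense (R : realFieldType) (x y : \bar R) : (x < y)%E ->
  exists r : R, (x < r%:E < y)%E.
Proof.
case: x y => [x||] [y||] //= => [|_|_|_].
- rewrite lte_fin => xy; exists ((x + y) / 2).
  by rewrite !lte_fin midf_lt//= midf_lt.
- by exists (x + 1); rewrite lte_fin ltrDl ltr01 ltry.
- by exists (y - 1); rewrite lte_fin gtrDl oppr_lt0 ltr01 ltNyr.
- by exists 0; rewrite ltNyr ltry.
Qed.

(** * Differences of shifted monotone sublinear functions *)

Section MonotoneSublinear.
Variables (R : realType) (U V : R -> R).
Hypothesis U_homo : {homo U : x y / x <= y}.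
Hypothesis V_homo : {homo V : x y / x <= y}.
Hypotheses (U_subl : sublinear U) (V_subl : sublinear V).

Let t (c M : R) : R := U (M + c) - V (M - c).

Lemma shifted_diff_homo M : {homo t ^~ M : a b / a <= b}.
Proof. by move=> a b ab; rewrite /t lerB// ?U_homo// ?V_homo//; lra. Qed.

(* Along M = M0 + n (b - a) the increments of U and of V telescope, so a gap
   bounded below would make U + V grow at least linearly. *)
Lemma shifted_diff_no_gap a b e : a < b -> 0 < e ->
  ~ \forall M \near +oo, t a M + e <= t b M.
Proof.
move=> ab e0 [M1 [_ gap]].
(* The first bound puts [M0] where the gap holds; the second keeps the arguments of [U] and [V]
   nonnegative, where sublinearity applies. *)
pose M0 := Num.max (M1 + 1) (`|a| + `|b|).
have M01 : M1 < M0 by rewrite /M0 lt_max; apply/orP; left; lra.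
have M0ab : `|a| + `|b| <= M0 by rewrite /M0 le_max lexx orbT.
have := ler_norm (- a); rewrite normrN => na.
have nb := ler_norm b.
have h0 : 0 < b - a by lra.
pose S n := U (M0 + a + n%:R * (b - a)) + V (M0 - b + n%:R * (b - a)).
have S_ge n : S 0%N + n%:R * e <= S n.
  elim: n => [|n IHn]; first by rewrite mul0r addr0.
  have nh : 0 <= n%:R * (b - a) by rewrite mulr_ge0// ltW.
  have /gap : M1 < M0 + n%:R * (b - a) by lra.
  rewrite /t => gn.
  have -> : S n.+1 = U (M0 + n%:R * (b - a) + b) + V (M0 + n%:R * (b - a) - a).
    by rewrite /S -natr1; congr (U _ + V _); ring.
  move: IHn; rewrite {2}/S -natr1.
  have -> : M0 + a + n%:R * (b - a) = M0 + n%:R * (b - a) + a by ring.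
  have -> : M0 - b + n%:R * (b - a) = M0 + n%:R * (b - a) - b by ring.
  lra.
(* With this slope [U] and [V] are each allowed at most [e / 4] of growth per step, hence [e / 2]
   together, against the [e] forced by the gap. The constants left over are collected in [K], and
   [n] is taken with [K < n * (e / 2)]. *)
have d0 : 0 < e / (4 * (b - a)) by rewrite divr_gt0// mulr_gt0.
have [C1 UC] := U_subl d0; have [C2 VC] := V_subl d0.
set d := e / _ in d0 UC VC.
have dE : d * (b - a) = e / 4 by rewrite /d; field; lra.
pose K := C1 + C2 + d * (2 * M0 + a - b) - S 0%N.
have /archi_boundP := normr_ge0 (K / (e / 2)).
set n := Num.Def.archi_bound _ => Kn.
have := le_lt_trans (ler_norm _) Kn; rewrite ltr_pdivrMr ?divr_gt0// => {}Kn.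
have nh : 0 <= n%:R * (b - a) by rewrite mulr_ge0// ltW.
have Un : U (M0 + a + n%:R * (b - a)) <= C1 + d * (M0 + a + n%:R * (b - a)).
  by apply: UC; have := normr_ge0 b; lra.
have Vn : V (M0 - b + n%:R * (b - a)) <= C2 + d * (M0 - b + n%:R * (b - a)).
  by apply: VC; have := normr_ge0 a; lra.
have := S_ge n; rewrite {2}/S => Sn.
have dn : d * (n%:R * (b - a)) = n%:R * (e / 4) by rewrite -dE; ring.
move: Kn Un Vn; rewrite /K; lra.
Qed.

Lemma shifted_diff_lim_uniq a b (l l' : \bar R) :
  (t a M)%:E @[M --> +oo] --> l -> (t b M)%:E @[M --> +oo] --> l' -> l = l'.
Proof.
wlog ab : a b l l' / a <= b.
  move=> H la lb; have [ab|/ltW ba] := leP a b; first exact: H la lb.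
  by apply/esym; apply: H lb la.
move: ab; rewrite le_eqVlt => /predU1P[<- la lb|ab la lb].
  exact: cvg_unique la lb.
have ll' : (l <= l')%E.
  apply: (lee_cvg_to la lb); apply: nearW => M.
  by rewrite lee_fin shifted_diff_homo// ltW.
apply/eqP; rewrite eq_le ll' /=; rewrite leNgt; apply/negP => ltll'.
(* Two reals strictly between the limits yield an eventual gap [s - r], whether or not the limits
   are finite. *)
have [r /andP[lr rl']] := lte_dense ltll'.
have [s /andP[]] := lte_dense rl'; rewrite lte_fin => rs sl'.
apply: (@shifted_diff_no_gap a b (s - r)) => //; first by rewrite subr_gt0.
have tr := la _ (open_ereal_lt' lr).
have ts := lb _ (open_ereal_gt' sl').
near=> M.
have : ((t a M)%:E < r%:E)%E by near: M.
have : (s%:E < (t b M)%:E)%E by near: M.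
by rewrite !lte_fin; lra.
Unshelve. all: end_near. Qed.

(** Moving the centre outwards by [b - a] changes [t] by increments of [U] and [V] that are those
    between [a] and [b], taken at [M + (b - a)] or [M - (b - a)]; these vanish in the limit. *)
Lemma shifted_diff_cvg_step (a b l : R) : a < b ->
  t a M @[M --> +oo] --> l -> t b M @[M --> +oo] --> l ->
  t (b + (b - a)) M @[M --> +oo] --> l /\ t (a - (b - a)) M @[M --> +oo] --> l.
Proof.
move=> ab la lb.
have D0 : t b M - t a M @[M --> +oo] --> (0 : R).
  by rewrite -(subrr l); exact: cvgB.
(* The increments of [U] and [V] are nonnegative and add up to [t b M - t a M], so each is squeezed
   to 0. *)
have dU0 : U (M + b) - U (M + a) @[M --> +oo] --> (0 : R).
  apply: squeeze_cvgr (cvg_cst 0) D0; near=> M.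
  have : U (M + a) <= U (M + b) by apply: U_homo; lra.
  have : V (M - b) <= V (M - a) by apply: V_homo; lra.
  by rewrite /t /cst; lra.
have dV0 : V (M - a) - V (M - b) @[M --> +oo] --> (0 : R).
  apply: squeeze_cvgr (cvg_cst 0) D0; near=> M.
  have : U (M + a) <= U (M + b) by apply: U_homo; lra.
  have : V (M - b) <= V (M - a) by apply: V_homo; lra.
  by rewrite /t /cst; lra.
split.
- have -> : t (b + (b - a)) = fun M => t b M +
      ((U (M + (b - a) + b) - U (M + (b - a) + a)) +
      (V (M - (b - a) - a) - V (M - (b - a) - b))).
    apply/funext => M; rewrite /t.
    have -> : M + (b - a) + a = M + b by ring.
    have -> : M - (b - a) - a = M - b by ring.
    have -> : M - (b - a) - b = M - (b + (b - a)) by ring.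
    have -> : M + (b - a) + b = M + (b + (b - a)) by ring.
    ring.
  rewrite -[l in _ --> l](addr0 l) -[X in l + X](addr0 0).
  apply: cvgD => //; apply: cvgD.
    by rewrite (cvg_shiftr (b - a) (fun M => U (M + b) - U (M + a))).
  by rewrite (cvg_centerr (b - a) (fun M => V (M - a) - V (M - b))).
- have -> : t (a - (b - a)) = fun M => t a M -
      ((U (M - (b - a) + b) - U (M - (b - a) + a)) +
      (V (M + (b - a) - a) - V (M + (b - a) - b))).
    apply/funext => M; rewrite /t.
    have -> : M - (b - a) + b = M + a by ring.
    have -> : M + (b - a) - b = M - a by ring.
    have -> : M - (b - a) + a = M + (a - (b - a)) by ring.
    have -> : M + (b - a) - a = M - (a - (b - a)) by ring.
    ring.
  rewrite -[l in _ --> l](subr0 l) -[X in l - X](addr0 0).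
  apply: cvgB => //; apply: cvgD.
    by rewrite (cvg_centerr (b - a) (fun M => U (M + b) - U (M + a))).
  by rewrite (cvg_shiftr (b - a) (fun M => V (M - a) - V (M - b))).
Unshelve. all: end_near. Qed.

Lemma shifted_diff_cvg_all (a b l c : R) : a < b ->
  t a M @[M --> +oo] --> l -> t b M @[M --> +oo] --> l ->
  t c M @[M --> +oo] --> l.
Proof.
move=> ab la lb; have h0 : 0 < b - a by rewrite subr_gt0.
(* Each step triples the interval, but a reach growing linearly in [n] is enough to enclose any
   [c]. *)
have steps (n : nat) : exists a' b' : R,
    [/\ a' <= a - n%:R * (b - a), b + n%:R * (b - a) <= b',
        t a' M @[M --> +oo] --> l & t b' M @[M --> +oo] --> l].
  elim: n => [|n [a' [b' [aa' bb' la' lb']]]].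
    by exists a, b; rewrite mul0r subr0 addr0.
  have nh : 0 <= n%:R * (b - a) by rewrite mulr_ge0// ltW.
  have ab' : a' < b' by lra.
  have [lb'' la''] := shifted_diff_cvg_step ab' la' lb'.
  exists (a' - (b' - a')), (b' + (b' - a')); rewrite -natr1.
  by split => //; lra.
have /archi_boundP := normr_ge0 ((c - a) / (b - a)).
set n := Num.Def.archi_bound _ => cn.
have := cn; rewrite normrM normfV (gtr0_norm h0) ltr_pdivrMr// => {}cn.
have := ler_norm (c - a); have := ler_norm (- (c - a)); rewrite normrN => c1 c2.
have [a' [b' [aa' bb' la' lb']]] := steps n.
apply: squeeze_cvgr la' lb'; near=> M.
by apply/andP; split; apply: shifted_diff_homo; lra.
Unshelve. all: end_near. Qed.

End MonotoneSublinear.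

(** * Truncated means as differences of monotone sublinear functions *)

Section TruncatedMean.
Context (d : measure_display) (T : measurableType d) (R : realType).
Variables (P : probability T R) (X : {RV P >-> R}).

Let mu := distribution P X.

(** [pos_mean] and [neg_mean] are the U and V of the overview; the point 0 goes to [pos_mean] only,
    so that the two ranges are disjoint. *)
Definition pos_mean (y : R) : R := \int[mu]_(x in `[0, y]) x.
Definition neg_mean (y : R) : R := \int[mu]_(x in `[- y, 0[) (- x).

Lemma bounded_integrable (f : R -> R) (A : set R) K :
  measurable A -> measurable_fun A f -> (forall x, A x -> `|f x| <= K) ->
  mu.-integrable A (EFin \o f).
Proof.
move=> mA mf fK; apply: measurable_bounded_integrable => //.
  by rewrite (le_lt_trans (probability_le1 _ mA)) ?ltry.
exists K; split; first exact: num_real.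
by move=> M KM x Ax /=; rewrite (le_trans (fK x Ax)) ?ltW.
Qed.

Lemma Rintegral_le_cst (f : R -> R) (A : set R) K :
  measurable A -> measurable_fun A f -> (forall x, A x -> 0 <= f x <= K) ->
  \int[mu]_(x in A) f x <= K * fine (mu A).
Proof.
move=> mA mf fK; rewrite -Rintegral_cst//; apply: le_Rintegral => //.
- apply: (@bounded_integrable _ _ K) => // x /fK /andP[f0 ?].
  by rewrite ger0_norm.
- by apply: (@bounded_integrable _ _ `|K|).
- by move=> x /fK /andP[].
Qed.

Lemma Rintegral_subset_le (f : R -> R) (A B : set R) K :
  measurable A -> measurable B -> A `<=` B -> measurable_fun B f ->
  (forall x, B x -> 0 <= f x <= K) ->
  \int[mu]_(x in A) f x <= \int[mu]_(x in B) f x.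
Proof.
move=> mA mB AB mf fK.
have iB : mu.-integrable B (EFin \o f).
  apply: (@bounded_integrable _ _ K) => // x /fK /andP[f0 ?].
  by rewrite ger0_norm.
have iA := integrableS mB mA AB iB.
rewrite /Rintegral fine_le// ?integrable_fin_num//.
apply: ge0_subset_integral => //.
  exact/measurable_realfun.measurable_EFinP.
by move=> x /fK /andP[]; rewrite lee_fin.
Qed.

Lemma distribution_tail e : 0 < e ->
  exists2 K, 0 <= K & fine (mu (~` `[- K, K])) <= e.
Proof.
move=> e0; have e20 : 0 < e / 2 by rewrite divr_gt0.
have /fine_cvgP[_ /cvgrPdist_le/(_ _ e20) hy] := cvg_ccdfy0 X.
have /fine_cvgP[_ /cvgrPdist_le/(_ _ e20) hN] := cvg_cdfNy0 X.
case: hy => [a [_ ha]]; case: hN => [b [_ hb]].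
(* The [+ 1] places [K] and [- K] strictly beyond the thresholds [a] and [b] of the two tail
   estimates. *)
pose K := `|a| + `|b| + 1.
have aK : a < K by rewrite /K; have := ler_norm a; have := normr_ge0 b; lra.
have bK : - K < b.
  have := ler_norm (- b); rewrite normrN.
  by rewrite /K; have := normr_ge0 a; lra.
exists K; first by rewrite /K !addr_ge0.
have := ha _ aK; have := hb _ bK; rewrite /= !sub0r !normrN.
rewrite !ger0_norm ?fine_ge0// => {ha hb}hb ha.
have -> : ~` `[- K, K] = `]-oo, - K[ `|` `]K, +oo[ :> set R.
  by rewrite setCitv.
apply: (@le_trans _ _ (fine (cdf X (- K) + ccdf X K)%E)); last first.
  by rewrite fineD ?fin_num_measure//; lra.
rewrite fine_le ?fin_numD ?fin_num_measure//=; first exact: measurableU.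
apply: le_trans (measureU2 _ _ _) _ => //.
rewrite leeD2r// le_measure ?inE//.
by apply: subset_itvl; rewrite bnd_simp.
Qed.

(** Choose [K] so that the mass outside [[- K, K]] is at most [e]. Inside, the integrand is at most
    [K] and the mass at most 1; outside, the integrand is at most [y]. The integral is thus at most
    [K + e * y]. *)
Lemma sublinear_Rintegral (f : R -> R) (A : R -> set R) :
  (forall y, measurable (A y)) -> measurable_fun setT f ->
  (forall x y, A y x -> - y <= x <= y) ->
  (forall x y, A y x -> 0 <= f x <= `|x|) ->
  sublinear (fun y => \int[mu]_(x in A y) f x).
Proof.
move=> mA mf Ay f0 e e0; have [K K0 Ke] := distribution_tail e0.
exists K => y y0.
have mfA B : measurable_fun B f by exact: measurable_funS mf.
pose I : set R := `[- K, K]%classic.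
have mI : measurable I by exact: measurable_itv.
have fy x : A y x -> 0 <= f x <= y.
  move=> Ax; have /andP[-> /=] := f0 _ _ Ax; move/le_trans; apply.
  by rewrite ler_norml Ay.
rewrite -(setUIDK (A y) I) Rintegral_setU//; last 4 first.
- exact: measurableI.
- exact: measurableD.
- rewrite setUIDK; apply: (@bounded_integrable _ _ y) => // x /fy /andP[? ?].
  by rewrite ger0_norm.
- by apply/disj_setPS => x [[_ Ix] [_ /(_ Ix)]].
apply: lerD.
  apply: (@le_trans _ _ (K * fine (mu (A y `&` I)))).
    apply: Rintegral_le_cst => //; first exact: measurableI.
    move=> x [Ax]; rewrite /I /= in_itv /= => IK.
    have /andP[-> /=] := f0 _ _ Ax.
    by move/le_trans; apply; rewrite ler_norml.
  rewrite ler_piMr// -lee_fin fineK ?fin_num_measure//; last exact: measurableI.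
  by apply: probability_le1; exact: measurableI.
apply: (@le_trans _ _ (y * fine (mu (A y `\` I)))).
  apply: Rintegral_le_cst => //; first exact: measurableD.
  by move=> x [Ax _]; exact: fy.
have mC : measurable (~` I) by exact: measurableC.
have mD : measurable (A y `\` I) by exact: measurableD.
rewrite mulrC ler_wpM2r// (le_trans _ Ke)// fine_le ?fin_num_measure//.
by rewrite le_measure ?inE// => x [].
Qed.

Lemma pos_mean_homo : {homo pos_mean : x y / x <= y}.
Proof.
move=> x y xy; apply: (@Rintegral_subset_le _ _ _ y) => //.
by apply: subset_itvl; rewrite bnd_simp.
Qed.

Lemma neg_mean_homo : {homo neg_mean : x y / x <= y}.
Proof.
move=> x y xy; apply: (@Rintegral_subset_le _ _ _ y) => //.
- by apply: subset_itvr; rewrite bnd_simp lerN2.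
- by move=> z /=; rewrite in_itv /=; lra.
Qed.

Lemma pos_mean_sublinear : sublinear pos_mean.
Proof.
apply: sublinear_Rintegral => //.
- by move=> x y /=; rewrite in_itv /=; lra.
- by move=> x y /=; rewrite in_itv /= => /andP[x0 _]; rewrite x0 ler_norm.
Qed.

Lemma neg_mean_sublinear : sublinear neg_mean.
Proof.
apply: sublinear_Rintegral => //.
- by move=> x y /=; rewrite in_itv /=; lra.
- move=> x y /=; rewrite in_itv /= => /andP[_ x0].
  by rewrite oppr_ge0 ltW//= -normrN ler_norm.
Qed.

(** The hypothesis places 0 in the window, which is then cut there. *)
Lemma truncated_meanE c M : `|c| <= M ->
  truncated_mean X c M = (pos_mean (M + c) - neg_mean (M - c))%:E.
Proof.
rewrite ler_norml => /andP[cM Mc].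
have iI (I : interval R) : [set` I] `<=` `[c - M, c + M] ->
    mu.-integrable [set` I] (EFin \o id).
  move=> sI; apply: (@bounded_integrable _ _ (M + M)) => // x /sI /=.
  by rewrite in_itv /= ler_norml; lra.
have iA := iI `[c - M, c + M] (@subset_refl _ _).
rewrite /truncated_mean -[LHS]fineK; last exact: integrable_fin_num iA.
congr EFin; rewrite -[LHS]/(\int[mu]_(x in `[c - M, c + M]) x).
have sU : [set` `[c - M, c + M]] = `[c - M, 0[ `|` `[0, c + M] :> set R.
  by rewrite -itv_bndbnd_setU// bnd_simp; lra.
rewrite sU Rintegral_setU//; last 2 first.
- by rewrite -sU.
- apply/disj_setPS => x [] /=; rewrite !in_itv /=; lra.
rewrite addrC /pos_mean /neg_mean opprB (addrC M); congr (_ + _).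
under [in RHS]eq_Rintegral do rewrite -mulN1r.
rewrite RintegralZl ?mulN1r ?opprK//; apply: iI; rewrite sU; exact: subsetUl.
Qed.

Lemma truncated_mean_cvgE c (l : \bar R) :
  (truncated_mean X c M @[M --> +oo] --> l) <->
  ((pos_mean (M + c) - neg_mean (M - c))%:E @[M --> +oo] --> l).
Proof.
have E : \forall M \near +oo, truncated_mean X c M =
    (pos_mean (M + c) - neg_mean (M - c))%:E.
  by near=> M; apply: truncated_meanE.
split; apply: cvg_trans; apply: near_eq_cvg => //.
by apply: filterS E => M ->.
Unshelve. all: end_near. Qed.

End TruncatedMean.

(** * Transfer to the limits [L] *)

Section LimitMean.
Context (d : measure_display) (T : measurableType d) (R : realType).
Variables (P : probability T R) (X : {RV P >-> R}).

Lemma L_cvg c (l : \bar R) : truncated_mean X c M @[M --> +oo] --> l ->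
  L_exists X c /\ L X c = l.
Proof.
move=> cl; split; first by apply/cvg_ex; exists l.
exact: cvg_lim cl.
Qed.

Lemma L_unique a b : L_exists X a -> L_exists X b -> L X a = L X b.
Proof.
move=> /truncated_mean_cvgE La /truncated_mean_cvgE Lb.
apply: shifted_diff_lim_uniq La Lb;
  [exact: pos_mean_homo|exact: neg_mean_homo
  |exact: pos_mean_sublinear|exact: neg_mean_sublinear].
Qed.

Lemma L_exists_fin a b c : a < b -> L_exists X a -> L_exists X b ->
  L X a \is a fin_num -> L_exists X c.
Proof.
move=> ab La Lb fa.
have lab := L_unique La Lb.
move: La Lb => /truncated_mean_cvgE + /truncated_mean_cvgE.
rewrite -/(L X a) -/(L X b) -lab -(fineK fa) => /fine_cvg La /fine_cvg Lb.
suff /L_cvg[] : truncated_mean X c M @[M --> +oo] --> (fine (L X a))%:E by [].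
apply/truncated_mean_cvgE/cvg_EFin; first exact: nearW.
apply: shifted_diff_cvg_all ab La Lb;
  [exact: pos_mean_homo|exact: neg_mean_homo].
Qed.

Lemma L_pinfty_le a b : a <= b -> L_exists X a -> L X a = +oo%E ->
  L_exists X b.
Proof.
move=> ab La ay; have [] // : L_exists X b /\ L X b = +oo%E.
apply: L_cvg; apply/truncated_mean_cvgE.
move: La => /truncated_mean_cvgE; rewrite -/(L X a) ay; apply: gee_cvgy.
apply: nearW => M; rewrite lee_fin.
by apply: shifted_diff_homo ab; [exact: pos_mean_homo|exact: neg_mean_homo].
Qed.

Lemma L_ninfty_ge a b : a <= b -> L_exists X b -> L X b = -oo%E ->
  L_exists X a.
Proof.
move=> ab Lb bNy; have [] // : L_exists X a /\ L X a = -oo%E.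
apply: L_cvg; apply/truncated_mean_cvgE.
move: Lb => /truncated_mean_cvgE; rewrite -/(L X b) bNy; apply: lee_cvgNy.
apply: nearW => M; rewrite lee_fin.
by apply: shifted_diff_homo ab; [exact: pos_mean_homo|exact: neg_mean_homo].
Qed.

End LimitMean.

(** * Case analysis on the set of centres where the limit exists *)

Lemma up_closed_threshold (R : realType) (E : set R) (x y : R) :
  (forall a b, a <= b -> E a -> E b) -> E y -> ~ E x ->
  exists c0, (forall c, c0 < c -> E c) /\ (forall c, c < c0 -> ~ E c).
Proof.
move=> Eup Ey nEx.
have lbx : lbound E x.
  by move=> z Ez; rewrite leNgt; apply/negP => /ltW /Eup/(_ Ez).
(* The infimum is a genuine one: [y] makes [E] nonempty and [x] bounds it below. Membership of the
   infimum itself is left open. *)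
exists (inf E); split=> c cE.
  have [z Ez /ltW zc] := inf_lt (ex_intro _ y Ey : E !=set0) cE.
  exact: Eup zc Ez.
by move=> Ec; have := ge_inf (ex_intro _ x lbx) Ec; rewrite leNgt cE.
Qed.

Lemma exactly_one_intro (Ps : seq Prop) :
  (exists i, nth False Ps i) ->
  (forall i j, (i < j)%N -> nth False Ps i -> ~ nth False Ps j) ->
  exactly_one Ps.
Proof.
move=> [i Pi] excl; exists i; split=> // j Pj.
by case: (ltngtP i j) => // [/excl/(_ Pi)|/excl/(_ Pj)].
Qed.

(** The classification is pure order reasoning about an existence set [E] and values [l], free of
    measure theory. *)
Lemma exactly_one_limit_case (R : realType) (E : R -> Prop) (l : R -> \bar R) :
  (forall a b, E a -> E b -> l a = l b) ->
  (forall a b c, a < b -> E a -> E b -> l a \is a fin_num -> E c) ->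
  (forall a b, a <= b -> E a -> l a = +oo%E -> E b) ->
  (forall a b, a <= b -> E b -> l b = -oo%E -> E a) ->
  exactly_one
    [:: (forall c : R, ~ E c);
        (exists! c : R, E c /\ l c \is a fin_num);
        (forall c : R, E c) /\ (forall c c' : R, l c = l c');
        (exists c0 : R,
           (forall c : R, c0 < c -> E c /\ l c = +oo%E) /\
           (forall c : R, c < c0 -> ~ E c));
        (exists c0 : R,
           (forall c : R, c < c0 -> E c /\ l c = -oo%E) /\
           (forall c : R, c0 < c -> ~ E c))].
Proof.
move=> l_unique E_fin E_pinfty E_ninfty.
apply: exactly_one_intro; last first.
  have ltS (x : R) : x < x + 1 by rewrite ltrDl.
  have gtS (x : R) : x - 1 < x by rewrite gtrDl oppr_lt0.
  (* Indices past 4 select [False], which leaves ten pairs to refute; [c0 + 1] and [c0 - 1] serve as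
     test points beside a threshold. *)
  move=> [|[|[|[|[|i]]]]] [|[|[|[|[|j]]]]] //= _;
    rewrite ?nth_nil; try by move=> _ [].
  - by move=> H [c [[/H]]].
  - by move=> H [/(_ 0)/H].
  - by move=> H [c [/(_ _ (ltS c))[/H]]].
  - by move=> H [c [/(_ _ (gtS c))[/H]]].
  - move=> [c [[ec fc] uc]] [ex eqL].
    have /uc cE : E (c + 1) /\ l (c + 1) \is a fin_num.
      by split => //; rewrite (eqL _ c).
    by have := ltS c; rewrite -cE ltxx.
  - move=> [c [[ec fc] _]] [c0 [/(_ _ (ltS c0))[ec0 Ly] _]].
    by move: fc; rewrite (l_unique _ _ ec ec0) Ly.
  - move=> [c [[ec fc] _]] [c0 [/(_ _ (gtS c0))[ec0 Ly] _]].
    by move: fc; rewrite (l_unique _ _ ec ec0) Ly.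
  - by move=> [ex _] [c0 [_ /(_ _ (gtS c0))]]; apply.
  - by move=> [ex _] [c0 [_ /(_ _ (ltS c0))]]; apply.
  - move=> [c0 [H _]] [c1 [_ H1]].
    have c01 : c0 < Num.max c0 c1 + 1.
      by rewrite (le_lt_trans _ (ltS _))// le_max lexx.
    apply: (H1 (Num.max c0 c1 + 1)); last exact: (H _ c01).1.
    by rewrite (le_lt_trans _ (ltS _))// le_max lexx orbT.
(* Outside cases i) and iii) there are [a] in [E] and [b] not in [E]; the value [l a], shared by all
   of [E], then selects the case. *)
have [none|/existsNP[a /contrapT ea]] := pselect (forall c, ~ E c).
  by exists 0%N.
have [all|/existsNP[b nb]] := pselect (forall c, E c).
  by exists 2%N; split => // c c'; exact: l_unique.
case aE : (l a) => [r||].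
- have fa : l a \is a fin_num by rewrite aE.
  exists 1%N, a; split => // c [ec fc].
  (* A second point with a finite limit would force [b] into [E]. *)
  by have [ac|ca|//] := ltgtP a c; case: nb;
    [exact: E_fin _ _ _ ac ea ec fa|exact: E_fin _ _ _ ca ec ea fc].
- have Ly c : E c -> l c = +oo%E by move=> /(l_unique _ _ ea) <-.
  have [|c0 [H1 H2]] := up_closed_threshold _ ea nb.
    by move=> c c' cc' ec; exact: E_pinfty _ _ cc' ec (Ly _ ec).
  exists 3%N, c0; split => // c /H1 ec.
  by split; [|exact: Ly].
- have Ly c : E c -> l c = -oo%E by move=> /(l_unique _ _ ea) <-.
  (* Here [E] is closed downwards, so its complement is closed upwards and the roles of [a] and [b]
     are exchanged. *)
  have [||c0 [H1 H2]] :=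
      @up_closed_threshold _ [set c | ~ E c] a b _ nb.
  + by move=> c c' cc' nc ec; apply: nc; exact: E_ninfty _ _ cc' ec (Ly _ ec).
  + by apply.
  exists 4%N, c0; split => // c /H2/contrapT ec.
  by split; [|exact: Ly].
Qed.

Theorem theorem3p3 (d : measure_display) (T : measurableType d) (R : realType)
    (P : probability T R) (X : {RV P >-> R}) :
  exactly_one
    [:: (forall c : R, ~ L_exists X c);
        (exists! c : R, L_exists X c /\ L X c \is a fin_num);
        (forall c : R, L_exists X c) /\ (forall c c' : R, L X c = L X c');
        (exists c0 : R,
           (forall c : R, c0 < c -> L_exists X c /\ L X c = +oo%E) /\
           (forall c : R, c < c0 -> ~ L_exists X c));
        (exists c0 : R,
           (forall c : R, c < c0 -> L_exists X c /\ L X c = -oo%E) /\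
           (forall c : R, c0 < c -> ~ L_exists X c))].
Proof.
apply: exactly_one_limit_case;
  [exact: L_unique|exact: L_exists_fin|exact: L_pinfty_le|exact: L_ninfty_ge].
Qed.
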